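(* Let $X$ be a real Hilbert space and let $A\colon X\rightrightarrows X$ and $B\colon X\rightrightarrows X$ be maximally monotone and paramonotone, with $\operatorname{zer}A\cap\operatorname{zer}B\neq\varnothing$. Then the following hold: (i) $Z=(\operatorname{zer}A)\cap(\operatorname{zer}B)$ and $0\in K$. (ii) $J_AP_{\operatorname{Fix} T_{\mathrm{DR}}}=P_Z$. (iii) $K\perp(Z-Z)$. If, in addition, $A$ or $B$ is single-valued, then also: (iv) $K=\{0\}$. (v) $\operatorname{Fix}T_{\mathrm{DR}}=(\operatorname{zer}A)\cap(\operatorname{zer}B)$.
   Context: A set-valued operator $C\colon X\rightrightarrows X$ is monotone if $\langle x-y,u-v\rangle\ge 0$ for all $(x,u),(y,v)\in\operatorname{gra}C$, and maximally monotone if no monotone operator has a graph properly containing $\operatorname{gra} C$. A monotone operator $C$ is paramonotone if whenever $(x,u),(y,v)\in\operatorname{gra}C$ and $\langle x-y,u-v\rangle=0$, then $(x,v),(y,u)\in\operatorname{gra}C$. $\operatorname{zer}C=C^{-1}(0)$, $J_C=(\mathrm{Id}+C)^{-1}$, $R_C=2J_C-\mathrm{Id}$. The Douglas–Rachford operator of $(A,B)$ is $T_{\mathrm{DR}}=\mathrm{Id}-J_A+J_BR_A$. The primal solution set is $Z=(A+B)^{-1}(0)=\{x : 0\in Ax+Bx\}$ and the dual solution set is $K=\big(A^{-1}+(-\mathrm{Id})\circ B^{-1}\circ(-\mathrm{Id})\big)^{-1}(0)$. $\operatorname{Fix}$ denotes the fixed point set; $P_C$ is the projector onto a nonempty closed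 convex set $C$. $Z-Z=\{z_1-z_2 : z_1,z_2\in Z\}$, and $K\perp(Z-Z)$ means $\langle k,w\rangle=0$ for all $k\in K$, $w\in Z-Z$. *)

(* Defs.v *)
From HB Require Import structures.
From mathcomp Require Import all_boot all_order all_algebra.
From mathcomp Require Import all_classical all_reals all_analysis.
Import Order.TTheory GRing.Theory Num.Theory.
Import numFieldNormedType.Exports.

Set Implicit Arguments.
Unset Strict Implicit.
Unset Printing Implicit Defensive.

Local Open Scope classical_set_scope.
Local Open Scope ring_scope.

(* A real Hilbert space: a complete normed space whose norm is the one induced
   by a positive definite symmetric bilinear form. *)
HB.mixin Record CompleteNormedModule_isHilbert (R : realType) X
    of CompleteNormedModule R X := {
  inner : {dot X for (@idfun R)} ;
  normE_inner : forall x : X, `|x| = Num.sqrt (inner x x)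
}.

#[short(type="hilbertType")]
HB.structure Definition Hilbert (R : realType) :=
  {X of CompleteNormedModule R X & CompleteNormedModule_isHilbert R X}.

Notation "⟨ x , y ⟩" := (inner x y) (at level 0, format "⟨ x ,  y ⟩").

Section SetValuedOperators.
Context {R : realType} {X : hilbertType R}.
Implicit Types (A B C D : X -> set X) (S T : set X).

Definition gra C : set (X * X) := [set p | C p.1 p.2].

(* Functions are identified with single-valued operators. *)
Definition op_fun (f : X -> X) : X -> set X := fun x => [set f x].

Definition op_id : X -> set X := op_fun id.

Definition op_opp : X -> set X := op_fun -%R.

Definition op_inv C : X -> set X := fun u => [set x | C x u].

Definition op_add C D : X -> set X :=
  fun x => [set u + v | u in C x & v in D x].

Definition op_sub C D : X -> set X :=
  fun x => [set u - v | u in C x & v in D x].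

Definition op_scale (a : R) C : X -> set X :=
  fun x => [set a *: u | u in C x].

Definition op_comp C D : X -> set X := fun x => \bigcup_(y in D x) C y.

Definition monotone_op C := forall x y u v,
  gra C (x, u) -> gra C (y, v) -> 0 <= ⟨x - y, u - v⟩.

Definition maximally_monotone C :=
  monotone_op C /\ forall D, monotone_op D -> ~ (gra C `<` gra D).

Definition paramonotone C := monotone_op C /\ forall x y u v,
  gra C (x, u) -> gra C (y, v) -> ⟨x - y, u - v⟩ = 0 ->
  gra C (x, v) /\ gra C (y, u).

(* C x is a singleton for x in the domain of C, which may be a proper subset. *)
Definition single_valued C := forall x, is_subset1 (C x).

Definition zer C : set X := op_inv C 0.

Definition fixpoints C : set X := [set x | C x x].

(* When C is maximally monotone this has exactly one value at each point, so
   the set-valued algebra below agrees with the algebra of functions. *)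
Definition resolvent C : X -> set X := op_inv (op_add op_id C).

Definition reflected_resolvent C : X -> set X :=
  op_sub (op_scale 2 (resolvent C)) op_id.

Definition DouglasRachford A B : X -> set X :=
  op_add (op_sub op_id (resolvent A))
         (op_comp (resolvent B) (reflected_resolvent A)).

Definition primal_sol A B : set X := zer (op_add A B).

Definition dual_sol A B : set X :=
  zer (op_add (op_inv A) (op_comp op_opp (op_comp (op_inv B) op_opp))).

(* The nearest point of S to x, which exists and is unique when S is nonempty,
   closed and convex; the value is 0 if S has no nearest point to x. *)
Definition projector S (x : X) : X :=
  xget 0 [set p | S p /\ forall s, S s -> `|x - p| <= `|x - s|].

Definition set_sub S T : set X := [set s - t | s in S & t in T].

Definition set_orth S T := forall s t, S s -> T t -> ⟨s, t⟩ = 0.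

End SetValuedOperators.

(* Main.v *)
(* Fix T consists of the points z + k with k in A z and -k in B z. By
   paramonotonicity, every primal solution z can be paired with every dual
   solution k, so that Fix T = Z + K; a common zero z0 puts 0 in K. Monotonicity
   of A makes K orthogonal to Z - Z, hence
   |x - (z + k)|^2 = |x - z|^2 + |(x - z0) - k|^2 - |x - z0|^2,
   and the point of Fix T nearest to x is the sum of the projections of x on Z
   and of x - z0 on K. The resolvent of A maps such a sum z + k to z. *)
Require Import Defs.
From mathcomp Require Import all_boot all_order all_algebra.
From mathcomp Require Import all_classical all_reals all_analysis.
From mathcomp Require Import lra.
Import Order.TTheory GRing.Theory Num.Theory.
Import numFieldNormedType.Exports.
Local Open Scope classical_set_scope.
Local Open Scope ring_scope.

Set Implicit Arguments.
Unset Strict Implicit.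
Unset Printing Implicit Defensive.

(** * Inner product identities and continuity *)

Section InnerProduct.
Context {R : realType} {X : hilbertType R}.
Implicit Types (x y z u v w k : X) (S : set X).

Lemma innerC x y : ⟨x, y⟩ = ⟨y, x⟩.
Proof. by rewrite hermC expr0 mul1r. Qed.

Lemma innerDl x y z : ⟨x + y, z⟩ = ⟨x, z⟩ + ⟨y, z⟩.
Proof. exact: linearDl. Qed.

Lemma innerNl x y : ⟨- x, y⟩ = - ⟨x, y⟩.
Proof. exact: linearNl. Qed.

Lemma innerZl a x y : ⟨a *: x, y⟩ = a * ⟨x, y⟩.
Proof. exact: linearZl_LR. Qed.

Lemma innerDr x y z : ⟨z, x + y⟩ = ⟨z, x⟩ + ⟨z, y⟩.
Proof. by rewrite innerC innerDl !(innerC z). Qed.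

Lemma innerNr x y : ⟨y, - x⟩ = - ⟨y, x⟩.
Proof. by rewrite innerC innerNl innerC. Qed.

Lemma innerZr a x y : ⟨y, a *: x⟩ = a * ⟨y, x⟩.
Proof. by rewrite innerC innerZl innerC. Qed.

Lemma inner0l x : ⟨0, x⟩ = 0.
Proof. by rewrite -(scale0r 0) innerZl mul0r. Qed.

Definition innerE := (innerDl, innerDr, innerNl, innerNr, innerZl, innerZr).

Lemma sqr_norm_inner x : `|x| ^+ 2 = ⟨x, x⟩.
Proof.
rewrite normE_inner sqr_sqrtr //.
have [->|x0] := eqVneq x 0; first by rewrite inner0l.
exact/ltW/neq0_dnorm_gt0.
Qed.

Lemma ler_norm_sqr x y : (`|x| <= `|y|) = (`|x| ^+ 2 <= `|y| ^+ 2).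
Proof. by rewrite ler_pXn2r // nnegrE. Qed.

Lemma inner_polarization x y :
  ⟨x, y⟩ = (`|x + y| ^+ 2 - `|x| ^+ 2 - `|y| ^+ 2) / 2.
Proof. by rewrite !sqr_norm_inner !innerE (innerC y x); lra. Qed.

(** Polarization expresses the inner product through norms, which are continuous. *)
Lemma inner_continuousl y : continuous (fun x => ⟨x, y⟩ : R).
Proof.
rewrite (_ : (fun x => _) = fun x : X =>
  (`|x + y| * `|x + y| - `|x| * `|x| - `|y| * `|y|) / 2); last first.
  by apply/funext => x; rewrite inner_polarization !expr2.
move=> x; have cN (f : X -> X) : {for x, continuous f} ->
    {for x, continuous (fun z => `|f z| : R)}.
  by move=> cf; apply: continuous_comp => //; exact: norm_continuous.
have cxy : {for x, continuous (fun z => `|z + y| : R)}.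
  by apply: cN; apply: cvgD; [exact: cvg_id|exact: cvg_cst].
have cx : {for x, continuous (fun z => `|z| : R)} by apply: cN; exact: cvg_id.
by apply: cvgM; [apply: cvgB; [apply: cvgB; apply: cvgM|]|];
  by [|exact: cvg_cst].
Qed.

Lemma closed_halfspace y w : closed [set x : X | 0 <= ⟨x - y, w⟩].
Proof.
rewrite (_ : mkset _ = (fun x => ⟨x, w⟩ : R) @^-1` [set t | ⟨y, w⟩ <= t]).
  by apply: closed_comp => [x _|]; [exact: inner_continuousl|exact: closed_ge].
by apply/seteqP; split => x /=; rewrite !innerE subr_ge0.
Qed.

(** * Midpoint convexity and nearest points *)

Definition midpoint x y : X := 2^-1 *: (x + y).

Definition midpoint_convex S :=
  forall x y, S x -> S y -> S (midpoint x y).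

Lemma midpoint_convex_halfspace y w : midpoint_convex [set x : X | 0 <= ⟨x - y, w⟩].
Proof. by move=> a b /=; rewrite /midpoint !innerE; lra. Qed.

Lemma midpoint_convexI S1 S2 : midpoint_convex S1 -> midpoint_convex S2 ->
  midpoint_convex (S1 `&` S2).
Proof. by move=> c1 c2 x y [? ?] [? ?]; split; [exact: c1|exact: c2]. Qed.

(** This is the parallelogram law for [x - p] and [x - q], whose sum is twice [x - midpoint p q]. *)
Lemma parallelogram_midpoint x p q : `|p - q| ^+ 2 =
  2 * `|x - p| ^+ 2 + 2 * `|x - q| ^+ 2 - 4 * `|x - midpoint p q| ^+ 2.
Proof.
rewrite /midpoint !sqr_norm_inner !innerE.
by rewrite (innerC q p) (innerC q x) (innerC p x); lra.
Qed.

Lemma sqr_norm_orth y w k : ⟨w, k⟩ = 0 ->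
  `|y - w - k| ^+ 2 = `|y - w| ^+ 2 + `|y - k| ^+ 2 - `|y| ^+ 2.
Proof.
move=> wk; rewrite !sqr_norm_inner !innerE (innerC w y) (innerC k y) (innerC k w) wk.
by lra.
Qed.

(** The predicate from which [projector] selects its value. *)
Definition nearest S x p := S p /\ forall s, S s -> `|x - p| <= `|x - s|.

(** The midpoint of two nearest points is no closer to [x] than they are, so the parallelogram
    identity makes their distance 0. *)
Lemma nearest_unique S x : midpoint_convex S -> is_subset1 (nearest S x).
Proof.
move=> cS p q [Sp hp] [Sq hq]; apply/subr0_eq/eqP.
rewrite -normr_le0 -[leRHS](normr0 X) ler_norm_sqr normr0 expr0n /=.
rewrite (parallelogram_midpoint x).
have := hp _ (cS _ _ Sp Sq); have := hq _ (cS _ _ Sp Sq).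
by rewrite !ler_norm_sqr; lra.
Qed.

(** A minimizing sequence is Cauchy by the parallelogram identity; its limit stays in [S] and
    attains the infimum. *)
Lemma nearest_ex S x : closed S -> midpoint_convex S -> S !=set0 ->
  exists p, nearest S x p.
Proof.
move=> clS cS S0.
pose D : set R := [set `|x - s| ^+ 2 | s in S].
have D0 : has_inf D.
  split; first by case: S0 => s Ss; exists (`|x - s| ^+ 2), s.
  by exists 0 => _ [s _ <-]; exact: sqr_ge0.
have dS s : S s -> inf D <= `|x - s| ^+ 2.
  by move=> Ss; apply: ge_inf; [case: D0|exists s].
have /choice[u hu] n : exists s, S s /\ `|x - s| ^+ 2 < inf D + n.+1%:R^-1.
  have [|_ [s Ss <-] hs] := @inf_adherent R D n.+1%:R^-1 _ D0.
    by rewrite invr_gt0.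
  by exists s.
have near_inv (e : R) : 0 < e -> \forall n \near \oo, n.+1%:R^-1 < e.
  by move=> e0; exact: near_infty_natSinv_lt (PosNum e0).
have cu : cvg (u @ \oo).
  apply: cauchy_cvg; apply: cauchy_exP => e e0.
  (* Two squared distances below [inf D + e ^+ 2 / 4], with that of the midpoint at least [inf D],
     give a squared gap below [e ^+ 2]. *)
  have e4 : 0 < e ^+ 2 / 4 by rewrite divr_gt0 ?exprn_gt0.
  have [N _ hN] := near_inv _ e4.
  exists (u N), N => // n /= Nn.
  rewrite -ball_normE /= -(ltr_pXn2r (n := 2)) ?nnegrE ?(ltW e0) //.
  have close m : (N <= m)%N -> `|x - u m| ^+ 2 < inf D + e ^+ 2 / 4.
    by move=> Nm; apply: lt_trans (hu m).2 _; rewrite ltrD2l; exact: hN.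
  rewrite (parallelogram_midpoint x).
  have := dS _ (cS _ _ (hu N).1 (hu n).1).
  by have := close _ (leqnn N); have := close _ Nn; lra.
exists (lim (u @ \oo)); split.
  by apply: (closed_cvg S clS _ _ cu); apply: nearW => n; case: (hu n).
move=> s Ss; rewrite ler_norm_sqr; apply: le_trans (dS s Ss).
apply/ler_addgt0Pr => e e0.
(* The bound holds eventually along [u] and defines a closed set, so it passes to the limit. *)
apply: (closed_cvg [set y : X | `|x - y| ^+ 2 <= inf D + e] _ _ _ cu).
  apply: (@closed_comp _ _ (fun y : X => `|x - y| ^+ 2) [set t | t <= inf D + e]).
    move=> y _; rewrite /prop_for /continuous_at; under eq_fun do rewrite expr2.
    rewrite expr2.
    have c : `|x - z| @[z --> y] --> `|x - y|.
      by apply: cvg_norm; apply: cvgB; [exact: cvg_cst|exact: cvg_id].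
    exact: cvgM.
  exact: closed_le.
apply: filterS (near_inv _ e0) => n ne /=.
by apply: le_trans (ltW (hu n).2) _; rewrite lerD2l ltW.
Qed.

Lemma projectorP S x p : midpoint_convex S -> nearest S x p -> projector S x = p.
Proof. by move=> cS Sp; apply: xget_subset1 => //; exact: nearest_unique. Qed.

End InnerProduct.

(** * Maximal monotonicity and resolvents *)

Section MonotoneOperators.
Context {R : realType} {X : hilbertType R}.
Implicit Types (A B C : X -> set X) (x y z u v k : X).

(** For the converse, adjoining [(x, u)] to the graph keeps it monotone, so by maximality the pair
    was already there. *)
Lemma maximally_monotoneP C x u : maximally_monotone C ->
  C x u <-> forall y v, C y v -> 0 <= ⟨x - y, u - v⟩.
Proof.
move=> [mC maxC]; split => [Cxu y v Cyv|h]; first exact: mC.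
apply: contrapT => nC.
apply: (maxC (fun y => [set v | C y v \/ (y = x /\ v = u)])).
  move=> a s b t; rewrite /gra /= => -[Cas|[-> ->]] [Cbt|[-> ->]].
  - exact: mC.
  - by rewrite -(opprB x) -(opprB u) innerNl innerNr opprK; exact: h.
  - exact: h.
  - by rewrite subrr inner0l.
split=> [[a s] /= ?|]; first by left.
by move=> /(_ (x, u)) /= /(_ (or_intror (conj erefl erefl))).
Qed.

(** Monotonicity is symmetric in the two coordinates. Since [zer C] is a value of [op_inv C], facts
    about values then apply to zero sets. *)
Lemma maximally_monotone_inv C : maximally_monotone C ->
  maximally_monotone (op_inv C).
Proof.
move=> [mC maxC]; split=> [u x v y /= Cx Cy|D mD [CD nDC]].
  by rewrite innerC; exact: mC.
apply: (maxC (op_inv D)) => [x u y v /= Du Dv|].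
  by rewrite innerC; exact: mD.
split=> [[x u] /= ?|DC]; first exact: (CD (u, x)).
by apply: nDC => -[u x] /= ?; exact: (DC (x, u)).
Qed.

(** By [maximally_monotoneP], each point of the graph cuts out a closed half-space, and [C x] is
    their intersection. *)
Lemma closed_maximally_monotone C x : maximally_monotone C -> closed (C x).
Proof.
move=> mC; rewrite (_ : C x =
  \bigcap_(p in gra C) [set u : X | 0 <= ⟨u - p.2, x - p.1⟩]).
  by apply: closed_bigI => p _; exact: closed_halfspace.
apply/seteqP; split => u /=; rewrite maximally_monotoneP //.
  by move=> h [y v] /= Cyv; rewrite innerC; exact: h.
by move=> h y v Cyv; rewrite innerC; exact: (h (y, v)).
Qed.

Lemma midpoint_convex_maximally_monotone C x : maximally_monotone C ->
  midpoint_convex (C x).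
Proof.
move=> mC u v Cu Cv; rewrite maximally_monotoneP // => y w Cyw.
by rewrite innerC; apply: midpoint_convex_halfspace => /=; rewrite innerC;
  apply: mC.1.
Qed.

Lemma resolventP C x y : resolvent C x y <-> C y (x - y).
Proof.
split=> [[_ -> [v Cv <-]]|Cy]; first by rewrite addrC addKr.
by exists y => //; exists (x - y) => //; rewrite addrC subrK.
Qed.

(** For two values [y] and [z], monotonicity at [(y, x - y)] and [(z, x - z)] says that minus the
    squared norm of [y - z] is nonnegative. *)
Lemma resolvent_subset1 C x : monotone_op C -> is_subset1 (resolvent C x).
Proof.
move=> mC y z /resolventP Cy /resolventP Cz; apply/subr0_eq/eqP.
rewrite -normr_le0 -[leRHS](normr0 X) ler_norm_sqr normr0 expr0n /=.
have := mC _ _ _ _ Cy Cz.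
rewrite (_ : x - y - (x - z) = - (y - z)).
  by rewrite innerNr sqr_norm_inner oppr_ge0.
by rewrite opprB addrA addrAC (addrAC x) subrr sub0r opprB addrC.
Qed.

(** * Primal solutions, dual solutions and fixed points as pairs *)

Lemma primal_solP A B z : primal_sol A B z <-> exists k, A z k /\ B z (- k).
Proof.
split=> [[u Au [v Bv /eqP]]|[k [Ak Bk]]].
  by rewrite addrC addr_eq0 => /eqP vu; exists u; rewrite -vu.
by exists k => //; exists (- k) => //; rewrite subrr.
Qed.

(** Together with [primal_solP], this makes the primal and dual solution sets the two projections of
    one set of pairs [(z, k)]. *)
Lemma dual_solP A B k : dual_sol A B k <-> exists z, A z k /\ B z (- k).
Proof.
split=> [[z Az [_ [y [_ -> By] ->] /eqP]]|[z [Az Bz]]].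
  by rewrite subr_eq0 => /eqP zy; exists z; split=> //; rewrite zy.
exists z => //; exists (- z); last by rewrite subrr.
by exists z => //; exists (- k).
Qed.

(** Take [z] in [resolvent A x] and [k = x - z]. The reflection of [x] is [z - k], and [x] is fixed
    when [resolvent B] sends it to [z], that is, when [B z (- k)]. *)
Lemma fixpoints_DouglasRachfordP A B x : monotone_op A ->
  fixpoints (DouglasRachford A B) x <->
  exists z k, [/\ A z k, B z (- k) & x = z + k].
Proof.
move=> mA; split.
  move=> [_ [_ -> [a Ja <-]] [b [_ [_ [a' Ja' <-] [_ -> <-]] Jb]]].
  rewrite -addrA -[RHS]addr0 => /addrI/eqP; rewrite addrC subr_eq0 => /eqP ba.
  (* The two occurrences of [resolvent A] choose values independently; monotonicity identifies
     them. *)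
  move: Jb; rewrite (resolvent_subset1 mA Ja' Ja) ba => /resolventP Ba.
  exists a, (x - a); split; first exact/resolventP.
    by rewrite opprB; move: Ba; rewrite addrAC scaler_nat mulr2n addrK.
  by rewrite addrC subrK.
move=> [z [k [Az Bz xE]]].
have Jz : resolvent A x z by apply/resolventP; rewrite xE addrC addKr.
exists k; first by exists x => //; exists z => //; rewrite xE addrC addKr.
exists z; last by rewrite addrC xE.
exists (2 *: z - x); first by exists (2 *: z); [exists z|exists x].
apply/resolventP.
by rewrite addrAC scaler_nat mulr2n addrK xE opprD addrA subrr add0r.
Qed.



(* ⟨z - y, k - l⟩ vanishes since it is nonnegative by monotonicity of A, and
   nonpositive by monotonicity of B. *)
Lemma paramonotone_solutions_exchange A B z k y l :
  paramonotone A -> paramonotone B ->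
  A z k -> B z (- k) -> A y l -> B y (- l) -> A z l /\ B z (- l).
Proof.
move=> [mA pA] [mB pB] Az Bz Ay By.
have zy0 : ⟨z - y, k - l⟩ = 0.
  have := mA _ _ _ _ Az Ay; have := mB _ _ _ _ Bz By.
  by rewrite -opprD innerNr oppr_ge0 => h1 h2; apply/eqP; rewrite eq_le h1 h2.
split; first by case: (pA _ _ _ _ Az Ay zy0).
by case: (pB _ _ _ _ Bz By) => //; rewrite -opprD innerNr zy0 oppr0.
Qed.

(** * Paramonotone operators with a common zero *)

Section CommonZero.
Context {A B : X -> set X} (z0 : X).
Hypotheses (maxA : maximally_monotone A) (maxB : maximally_monotone B).
Hypotheses (paraA : paramonotone A) (paraB : paramonotone B).
Hypotheses (Az0 : A z0 0) (Bz0 : B z0 0).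

Let Z := primal_sol A B.
Let K := dual_sol A B.
Let F := fixpoints (DouglasRachford A B).

(** Each of [z] and [k] has some partner, [l] and [y] respectively; exchanging partners pairs [z]
    with [k]. *)
Lemma solutions_in_gra z k : Z z -> K k -> A z k /\ B z (- k).
Proof.
move=> /primal_solP[l [Az Bz]] /dual_solP[y [Ay By]].
exact: (paramonotone_solutions_exchange paraA paraB Az Bz Ay By).
Qed.

Lemma dual_sol_common_zero : K 0.
Proof. by apply/dual_solP; exists z0; rewrite oppr0. Qed.

Lemma primal_sol_common_zero : Z z0.
Proof. by apply/primal_solP; exists 0; rewrite oppr0. Qed.

Lemma primal_sol_zeros : Z = zer A `&` zer B.
Proof.
apply/seteqP; split=> [z Zz|z [Az Bz]].
  by have [] := solutions_in_gra Zz dual_sol_common_zero; rewrite oppr0.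
by apply/primal_solP; exists 0; rewrite oppr0.
Qed.

(** Every dual solution pairs with [z0]; closedness and midpoint convexity of [K] thus come from the
    values at [z0]. *)
Lemma dual_sol_section : K = A z0 `&` -%R @^-1` B z0.
Proof.
apply/seteqP; split=> k; last by move=> [Ak Bk]; apply/dual_solP; exists z0.
by move=> Kk; exact: (solutions_in_gra primal_sol_common_zero Kk).
Qed.

Lemma closed_primal_sol : closed Z.
Proof.
by rewrite primal_sol_zeros; apply: closedI;
  apply: closed_maximally_monotone; apply: maximally_monotone_inv.
Qed.

Lemma midpoint_convex_primal_sol : midpoint_convex Z.
Proof.
by rewrite primal_sol_zeros; apply: midpoint_convexI;
  apply: midpoint_convex_maximally_monotone; apply: maximally_monotone_inv.
Qed.

Lemma closed_dual_sol : closed K.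
Proof.
rewrite dual_sol_section; apply: closedI; first exact: closed_maximally_monotone.
apply: closed_comp => [x _|]; first exact: oppr_continuous.
exact: closed_maximally_monotone.
Qed.

Lemma midpoint_convex_dual_sol : midpoint_convex K.
Proof.
rewrite dual_sol_section.
apply: midpoint_convexI; first exact: midpoint_convex_maximally_monotone.
move=> x y Bx By; rewrite /= /midpoint -scalerN opprD.
exact: midpoint_convex_maximally_monotone.
Qed.

(** Both [A x 0] and [A y k] hold, so monotonicity bounds the product by 0 on one side; swapping [x]
    and [y] gives the other. *)
Lemma dual_sol_orth : set_orth K (set_sub Z Z).
Proof.
have h x y k : Z x -> Z y -> K k -> ⟨k, x - y⟩ <= 0.
  move=> Zx Zy Kk.
  have [Ax _] := solutions_in_gra Zx dual_sol_common_zero.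
  have [Ay _] := solutions_in_gra Zy Kk.
  have := maxA.1 _ _ _ _ Ax Ay.
  by rewrite sub0r innerNr oppr_ge0 innerC.
move=> k _ Kk [x Zx [y Zy <-]]; apply/eqP; rewrite eq_le h //=.
by rewrite -oppr_le0 -innerNr opprB h.
Qed.

(** * The fixed point set as a sum, and its projector *)

Lemma fixpoints_DouglasRachford_sum x :
  F x <-> exists z k, [/\ Z z, K k & x = z + k].
Proof.
rewrite /F; split.
  move=> /(fixpoints_DouglasRachfordP _ _ maxA.1)[z [k [Az Bz ->]]].
  by exists z, k; split=> //; [apply/primal_solP; exists k|apply/dual_solP; exists z].
move=> [z [k [Zz Kk ->]]]; apply/fixpoints_DouglasRachfordP; first exact: maxA.1.
by have [Az Bz] := solutions_in_gra Zz Kk; exists z, k.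
Qed.

Lemma resolvent_sum_solutions z k : Z z -> K k -> resolvent A (z + k) z.
Proof.
move=> Zz Kk; apply/resolventP; rewrite addrC addKr.
by have [] := solutions_in_gra Zz Kk.
Qed.

(* As Z - z0 and K are orthogonal, minimizing the distance to Z + K
   amounts to minimizing separately over Z and over K. *)
Lemma sqr_dist_sum_solutions x z k : Z z -> K k ->
  `|x - (z + k)| ^+ 2 = `|x - z| ^+ 2 + (`|x - z0 - k| ^+ 2 - `|x - z0| ^+ 2).
Proof.
move=> Zz Kk; have zk : ⟨z - z0, k⟩ = 0.
  rewrite innerC; apply: dual_sol_orth => //.
  by exists z => //; exists z0 => //; exact: primal_sol_common_zero.
have := sqr_norm_orth (x - z0) zk.
by rewrite opprB addrA subrK -addrA -opprD => ->; rewrite addrA.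
Qed.

(** Comparing [z + k] with [y + k] cancels the part of the squared distance that depends on [k]. *)
Lemma nearest_fixpointsP x z k : Z z -> K k ->
  nearest F x (z + k) -> nearest Z x z.
Proof.
move=> Zz Kk [_ hF]; split=> // y Zy.
have Fy : F (y + k) by apply/fixpoints_DouglasRachford_sum; exists y, k.
by have := hF _ Fy; rewrite !ler_norm_sqr !sqr_dist_sum_solutions // lerD2r.
Qed.

Lemma nearest_fixpoints_ex x : exists p, nearest F x p.
Proof.
have [z [Zz hz]] := nearest_ex x closed_primal_sol midpoint_convex_primal_sol
  (ex_intro _ _ primal_sol_common_zero).
have [k [Kk hk]] := nearest_ex (x - z0) closed_dual_sol midpoint_convex_dual_sol
  (ex_intro _ _ dual_sol_common_zero).
exists (z + k); split; first by apply/fixpoints_DouglasRachford_sum; exists z, k.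
move=> _ /fixpoints_DouglasRachford_sum[y [l [Zy Kl ->]]].
rewrite ler_norm_sqr !sqr_dist_sum_solutions // lerD ?lerD2r -?ler_norm_sqr //.
  exact: hz.
exact: hk.
Qed.

Lemma resolvent_projector_fixpoints :
  op_comp (resolvent A) (op_fun (projector F)) = op_fun (projector Z).
Proof.
have JP x : resolvent A (projector F x) (projector Z x).
  have [p0 Fp0] := nearest_fixpoints_ex x.
  (* Existence of a nearest point rules out the default value 0 of [projector]. *)
  have Fp : nearest F x (projector F x) by apply: xgetPex; exists p0.
  have /fixpoints_DouglasRachford_sum[z [k [Zz Kk pE]]] := Fp.1.
  rewrite pE in Fp *.
  rewrite (projectorP midpoint_convex_primal_sol (nearest_fixpointsP Zz Kk Fp)).
  exact: resolvent_sum_solutions.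
(* [JP] supplies a value of the composition; monotonicity of [A] makes it the only one. *)
apply/funext => x; apply/seteqP; split=> [y [_ -> Jy]|_ ->].
  exact: (resolvent_subset1 maxA.1 Jy (JP x)).
by exists (projector F x).
Qed.

(** At [z0], [A] takes the values 0 and [k], and [B] takes 0 and [- k]. *)
Lemma single_valued_dual_sol : single_valued A \/ single_valued B -> K = [set 0].
Proof.
move=> sAB; apply/seteqP; split=> [k Kk|_ ->]; last exact: dual_sol_common_zero.
have [Ak Bk] := solutions_in_gra primal_sol_common_zero Kk.
case: sAB => [sA|sB]; first exact: sA Ak Az0.
by apply: oppr_inj; rewrite oppr0; exact: sB Bk Bz0.
Qed.

End CommonZero.

End MonotoneOperators.

Theorem theorem4p7 (R : realType) (X : hilbertType R) (A B : X -> set X)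
    (maxA : maximally_monotone A) (maxB : maximally_monotone B)
    (paraA : paramonotone A) (paraB : paramonotone B)
    (zerAB : zer A `&` zer B !=set0) :
  let Z := primal_sol A B in
  let K := dual_sol A B in
  let T := DouglasRachford A B in
  [/\ Z = zer A `&` zer B /\ K 0,
      op_comp (resolvent A) (op_fun (projector (fixpoints T))) = op_fun (projector Z),
      set_orth K (set_sub Z Z) &
      single_valued A \/ single_valued B ->
        K = [set 0] /\ fixpoints T = zer A `&` zer B].
Proof.
move=> Z K T; have [z0 [Az0 Bz0]] := zerAB.
have ZE : Z = zer A `&` zer B by exact: primal_sol_zeros Az0 Bz0.
have K0 : K 0 by exact: dual_sol_common_zero Az0 Bz0.
split=> //.
- exact: resolvent_projector_fixpoints Az0 Bz0.
- exact: dual_sol_orth Az0 Bz0.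
move=> sAB; have KE : K = [set 0] by exact: single_valued_dual_sol Az0 Bz0 sAB.
split=> //; rewrite -ZE; apply/seteqP; split=> x.
  move=> /(fixpoints_DouglasRachford_sum maxA paraA paraB)[z [k [Zz Kk ->]]].
  by move: Kk; rewrite -/K KE => ->; rewrite addr0.
move=> Zx; apply/(fixpoints_DouglasRachford_sum maxA paraA paraB).
by exists x, 0; rewrite addr0.
Qed.
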